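(* If $l<c$, then for any quotation policy $D=(d_0,d_1,d_2,\ldots)$ the corresponding balking threshold $n_0(D)=\min\{n\ge0:B_n(d_n)<0\}$ satisfies $$\underline n\le n_0(D)\le\overline n,$$ where $$\underline n=\inf\{n\ge0:\lim_{d\to\infty}B_n(d)<0\}=\left\lfloor\frac{r(R-p)}{\ln\left(\frac{\mu}{\mu-rc}\right)}\right\rfloor,\qquad \overline n=\inf\{n\ge0:B_n(0)<0\}=\left\lfloor\frac{r(R-p)}{\ln\left(\frac{\mu}{\mu-r(c-l)}\right)}\right\rfloor.$$
   Context: Parameters: $\mu>0$ (service rate); service value $R$, entrance fee $p$, waiting cost rate $c>0$, compensation rate $l$, risk-aversion coefficient $r>0$, with $0\le p\le R$ and $0\le l\le c$. For each integer $n\ge 0$, $X_n\sim Gamma(n+1,\mu)$ has density $\mu^{n+1}x^ne^{-\mu x}/n!$ on $(0,\infty)$. A lead-time quote is $d\in[0,\infty]$; $d=\infty$ means no compensation, with $(x-\infty)^+=0$. A quotation policy $D=(d_0,d_1,\ldots)$ offers quote $d_n$ when $n$ customers are present. Expected utility of a joining customer who finds $n$ customers and is quoted $d$: $$B_n(d)=E\left[\frac{1-e^{-r(R-p-cX_n+l(X_n-d)^+)}}{r}\right]\in[-\infty,\infty).$$ It is $-\infty$ for all $n$ and $d$ if $\mu\le r(c-l)$. Convention: $\ln\left(\frac{\mu}{\mu-rc}\right)$ is read as $+\infty$ when $\mu\le rc$, and $\ln\left(\frac{\mu}{\mu-r(c-l)}\right)$ as $+\infty$ when $\mu\le r(c-l)$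 (the corresponding quotient being $0$). *)

(* Defs.v *)
From HB Require Import structures.
From mathcomp Require Import all_boot all_order all_algebra.
From mathcomp Require Import all_classical all_reals all_analysis.

Set Implicit Arguments.
Unset Strict Implicit.
Unset Printing Implicit Defensive.

Import Order.TTheory GRing.Theory Num.Theory.
Import numFieldNormedType.Exports.

Local Open Scope classical_set_scope.
Local Open Scope ring_scope.

(* Density of Gamma(n+1, mu): the shape is n.+1, not n. *)
Definition gammaS_pdf (R : realType) (mu : R) (n : nat) : R -> R :=
  (fun x => mu ^+ n.+1 * x ^+ n * expR (- (mu * x)) / n`!%:R) \_ `]0, +oo[.

Definition gammaS_distributed (R : realType) (d : measure_display)
    (T : measurableType d) (P : probability T R) (mu : R) (n : nat)
    (X : {RV P >-> R}) : Prop :=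
  forall A : set R, measurable A ->
    distribution P X A =
    (\int[@lebesgue_measure R]_(x in A) (gammaS_pdf mu n x)%:E)%E.

(* (x - q)^+, which is finite for every quote q in [0, +oo] and is 0 when
   q = +oo. *)
Definition lateness (R : realType) (x : R) (q : \bar R) : R :=
  fine (maxe (x%:E - q) 0)%E.

(* rew, p, c, l, r are the service value, the entrance fee, the waiting cost
   rate, the compensation rate and the risk-aversion coefficient; x is the
   time spent in the system and q is the quoted lead time. *)
Definition utility (R : realType) (rew p c l r : R) (q : \bar R) (x : R) : R :=
  (1 - expR (- r * (rew - p - c * x + l * lateness x q))) / r.

(* The utility is at most 1/r, so its positive part is integrable and the
   extended-real expectation takes the value -oo exactly when the negative
   part is not integrable. *)
Definition expected_utility (R : realType) (d : measure_display)
    (T : measurableType d) (P : probability T R) (X : {RV P >-> R})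
    (rew p c l r : R) (q : \bar R) : \bar R :=
  ('E_P[fun w => utility rew p c l r q (X w)])%E.

(* Infimum in [0, +oo] of a set of natural numbers; it is +oo on set0. *)
Definition nat_inf (R : realType) (S : set nat) : \bar R :=
  ereal_inf [set n%:R%:E | n in S].

Definition nat_min (S : set nat) (n : nat) : Prop := S n /\ lbound S n.

(* ln (mu / (mu - a)), read as +oo when mu <= a. *)
Definition ln_ratio (R : realType) (mu a : R) : \bar R :=
  if mu <= a then +oo%E else (ln (mu / (mu - a)))%:E.

(* floor (x / ln (mu / (mu - a))); the quotient is taken in \bar R, where
   (+oo)^-1 = 0, and it is finite whenever 0 < a. *)
Definition threshold_floor (R : realType) (x mu a : R) : int :=
  Num.floor (fine (x%:E / ln_ratio mu a)%E).

(* Main.v *)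
Require Import Defs.
From HB Require Import structures.
From mathcomp Require Import all_boot all_order all_algebra.
From mathcomp Require Import all_classical all_reals all_analysis.
From mathcomp Require Import measurable_realfun lra ring.

Set Implicit Arguments.
Unset Strict Implicit.
Unset Printing Implicit Defensive.

Import Order.TTheory GRing.Theory Num.Theory.
Import numFieldNormedType.Exports.

Local Open Scope classical_set_scope.
Local Open Scope ring_scope.

(** Write the utility as [1/r - k * disutility], where
    [k = exp(-r(rew - p))/r] and [disutility = exp(r(c X - l (X - q)^+))]. The
    disutility is nonnegative, so its expectation always exists in [0, +oo], and
    it is nondecreasing in the quote [q]: the customer is best off at 0 and
    worst off at +oo. At these two ends the exponent is linear in [X], with
    slope [s = r(c - l)] at 0 (because [X > 0]) and [s = r c] at +oo, so the
    expected disutility is the moment generating function of Gamma(n+1, mu) at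
    [s] ([expectation_expR_gamma]): it is [(mu/(mu - s))^(n+1)] for [s < mu] and
    [+oo] otherwise. By monotone convergence the value at [+oo] is also the
    limit for [q --> +oo] ([cvg_expected_disutility]).

    Taking logarithms, the utility at an end is negative exactly when
    [r(rew - p) < (n+1) ln(mu/(mu - s))], that is, when the floor of
    [r(rew - p)/ln(mu/(mu - s))] is at most [n] ([utility_lt0_threshold]). So
    the two infima are the two floors. For a policy [D], monotonicity puts
    [B n (D n)] between [B n +oo] and [B n 0]: it is negative at [n_hi], so the
    balking threshold exists and is at most [n_hi], and where it is negative so
    is [B n +oo], so the threshold is at least [n_lo].

    For the moment generating function no Gamma integral is computed: the
    exponential tilt of the density of rate [mu] is, up to a factor, that
    density after the substitution [x |-> (mu - s)/mu * x], and the total mass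
    is known to be 1 because [X] has this law. *)

(** * Integration against a density *)

(** The density [h] is almost everywhere the Radon-Nikodym derivative of [nu],
    for which the change of variables is known. *)
Lemma ge0_integral_density (d : measure_display) (T : measurableType d)
    (R : realType) (nu : {finite_measure set T -> \bar R})
    (mu : {sigma_finite_measure set T -> \bar R}) (h f : T -> \bar R) :
  measurable_fun [set: T] h -> (forall x, 0 <= h x)%E ->
  (forall A, measurable A -> nu A = \int[mu]_(x in A) h x)%E ->
  measurable_fun [set: T] f -> (forall x, 0 <= f x)%E ->
  (\int[nu]_x f x = \int[mu]_x (f x * h x))%E.
Proof.
move=> mh h0 nuE mf f0.
have numu : nu `<< mu.
  apply/null_content_dominatesP => A mA muA0.
  by rewrite nuE// null_set_integral//; exact: measurable_funTS.
rewrite -(Radon_Nikodym_SigmaFinite.change_of_variables numu)//.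
apply: ae_eq_integral => //.
- apply: emeasurable_funM => //.
  exact: measurable_int (Radon_Nikodym_SigmaFinite.f_integrable numu).
- exact: emeasurable_funM.
- apply: ae_eqe_mul2l; apply: integral_ae_eq => //.
  + exact: Radon_Nikodym_SigmaFinite.f_integrable.
  + by move=> E _ mE; rewrite -nuE// -Radon_Nikodym_SigmaFinite.f_integral.
Qed.

Lemma integral_cst_probability (d : measure_display) (T : measurableType d)
    (R : realType) (P : probability T R) (k : \bar R) :
  (\int[P]_x k = k)%E.
Proof.
rewrite integral_cst// -[RHS]mule1; congr (_ * _)%E.
exact: probability_setT.
Qed.

(** The case of interest is a non-integrable [f]: the left-hand side is then
    [-oo], because the positive part of [k - f] is bounded by [`|k|] while [f]
    is at most the negative part plus [`|k|]. *)
Lemma integral_cst_sub_ge0 (d : measure_display) (T : measurableType d)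
    (R : realType) (P : probability T R) (k : R) (f : T -> \bar R) :
  measurable_fun [set: T] f -> (forall x, 0 <= f x < +oo)%E ->
  (\int[P]_x (k%:E - f x) = k%:E - \int[P]_x f x)%E.
Proof.
move=> mf f0y.
have f0 x : (0 <= f x)%E by case/andP: (f0y x).
have mk : measurable_fun [set: T] (fun x => k%:E - f x)%E.
  by apply: emeasurable_funB.
have [fy|fy] := ltP (\int[P]_x f x)%E +oo%E.
  rewrite integralB ?integral_cst_probability//.
  - by apply/finite_measure_integrable_cst.
  - apply/integrableP; split => //.
    by under eq_integral do rewrite gee0_abs//.
move: fy; rewrite leye_eq => /eqP fy; rewrite fy addeNy integralE.
have -> : (\int[P]_x (fun x => k%:E - f x)^\- x = +oo)%E.
  have /= fle : (\int[P]_x f x <=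
     \int[P]_x ((fun x => k%:E - f x)^\- x + `|k|%:E))%E.
    apply: ge0_le_integral => //.
    - by apply: emeasurable_funD => //; exact: measurable_funeneg.
    - move=> x _; rewrite funenegE.
      have /andP[] := f0y x; case: (f x) => [y| |]// y0 _.
      rewrite -EFinB -EFinN -EFin_max -EFinD lee_fin.
      have := ler_norm k; have : - (k - y) <= Num.max (- (k - y)) 0.
        by rewrite le_max lexx.
      lra.
  move: fle; rewrite ge0_integralD//; last exact: measurable_funeneg.
  rewrite integral_cst_probability/= fy leye_eq.
  by case: (\int[P]_x _)%E.
suff : (\int[P]_x (fun x => k%:E - f x)^\+ x < +oo)%E.
  have : (0 <= \int[P]_x (fun x => k%:E - f x)^\+ x)%E by exact: integral_ge0.
  by case: (\int[P]_x _)%E.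
apply: (@le_lt_trans _ _ (\int[P]_x `|k|%:E)%E); last first.
  by rewrite integral_cst_probability/= ltry.
apply: ge0_le_integral => //; first exact: measurable_funepos.
move=> x _; rewrite funeposE.
have /andP[] := f0y x; case: (f x) => [y| |]// y0 _.
rewrite -EFinB -EFin_max lee_fin ge_max normr_ge0 andbT.
by move: y0; rewrite lee_fin; have := ler_norm k; lra.
Qed.

(** * The moment generating function of the Gamma law *)

(** The formula of the Gamma density, before restriction to [`]0, +oo[]; unlike
    the density it is continuous on the whole line. *)
Definition gamma_fun (R : realType) (mu : R) (n : nat) (x : R) : R :=
  mu ^+ n.+1 * x ^+ n * expR (- (mu * x)) / n`!%:R.

Lemma gamma_fun_ge0 (R : realType) (mu : R) (n : nat) (x : R) :
  0 < mu -> 0 <= x -> 0 <= gamma_fun mu n x.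
Proof.
move=> mu0 x0; rewrite /gamma_fun.
by rewrite !mulr_ge0 ?exprn_ge0 ?expR_ge0 ?invr_ge0// ltW.
Qed.

Lemma continuous_gamma_fun (R : realType) (mu : R) (n : nat) :
  continuous (gamma_fun mu n).
Proof.
pose e y := expR (- (mu * y)).
have ce : continuous e.
  move=> x; apply: (@continuous_comp _ _ _ (fun y => - (mu * y)) expR).
    by apply: continuousN; exact: mulrl_continuous.
  exact: continuous_expR.
rewrite (_ : gamma_fun mu n =
  ((cst (mu ^+ n.+1) \* (fun y => y ^+ n)) \* e) \* cst (n`!%:R)^-1)//.
move=> x; apply: continuousM; last exact: cst_continuous.
apply: continuousM; last exact: ce.
by apply: continuousM; [exact: cst_continuous|exact: exprn_continuous].
Qed.

Lemma measurable_gamma_fun (R : realType) (mu : R) (n : nat) :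
  measurable_fun [set: R] (gamma_fun mu n).
Proof.
by apply: continuous_measurable_fun; exact: continuous_gamma_fun.
Qed.

(** Every explicit value below is computed by this passage to the half-line,
    which also encodes that [X] is almost surely positive. *)
Lemma ge0_expectation_gamma (R : realType) (d : measure_display)
    (T : measurableType d) (P : probability T R) (mu : R) (n : nat)
    (X : {RV P >-> R}) (f : R -> R) :
  0 < mu -> gammaS_distributed mu n X ->
  measurable_fun [set: R] f -> (forall x, 0 <= f x) ->
  (\int[P]_w (f (X w))%:E =
   \int[@lebesgue_measure R]_(x in `]0%R, +oo[) (f x * gamma_fun mu n x)%:E)%E.
Proof.
move=> mu0 XG mf f0.
have mpdf : measurable_fun [set: R] (gammaS_pdf mu n).
  apply/(measurable_restrictT (gamma_fun mu n)) => //.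
  exact: measurable_funTS (measurable_gamma_fun mu n).
have pdf0 x : 0 <= gammaS_pdf mu n x.
  rewrite /gammaS_pdf patchE; case: ifPn => //; rewrite inE/= in_itv/= andbT.
  by move=> /ltW x0; exact: gamma_fun_ge0.
(* The type R and the domain of the Lebesgue measure carry the same
   sigma-algebra under two different displays; X' is X seen in the second. *)
have mX : measurable_fun [set: T] (X : T -> measurableTypeR R).
  exact: (measurable_funPT X).
pose X' : {mfun T >-> measurableTypeR R} :=
  HB.pack (X : T -> measurableTypeR R) (isMeasurableFun.Build _ _ _ _ _ mX).
have mEf : measurable_fun [set: measurableTypeR R] (EFin \o f).
  by have /measurable_EFinP := mf.
have mEpdf : measurable_fun [set: measurableTypeR R] (EFin \o gammaS_pdf mu n).
  by have /measurable_EFinP := mpdf.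
have -> : (\int[P]_w (f (X w))%:E = \int[distribution P X']_y (f y)%:E)%E.
  by rewrite (ge0_integral_distribution X' mEf)// => y; rewrite lee_fin.
rewrite (ge0_integral_density (nu := distribution P X')
  (mu := lebesgue_measure) mEpdf _ _ mEf)//.
rewrite [RHS]integral_mkcond; apply: eq_integral => x _ /=.
rewrite /gammaS_pdf !patchE; case: ifPn => // _.
by rewrite mule0.
Qed.

Definition gamma_mgf (R : realType) (mu : R) (n : nat) (s : R) : \bar R :=
  if s < mu then ((mu / (mu - s)) ^+ n.+1)%:E else +oo%E.

Lemma measurable_expRM (R : realType) (s : R) :
  measurable_fun [set: R] (fun x => expR (s * x)).
Proof.
by apply: measurableT_comp => //; exact: mulrl_measurable.
Qed.

(** With [k = (mu - s)/mu], the substitution [x |-> k x] turns the total mass 1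
    of the density into [k^(n+1)] times the expectation. *)
Lemma expectation_expR_gamma_lt (R : realType) (d : measure_display)
    (T : measurableType d) (P : probability T R) (mu : R) (n : nat)
    (X : {RV P >-> R}) (s : R) :
  0 < mu -> gammaS_distributed mu n X -> s < mu ->
  (\int[P]_w (expR (s * X w))%:E = ((mu / (mu - s)) ^+ n.+1)%:E)%E.
Proof.
move=> mu0 XG smu.
rewrite (ge0_expectation_gamma mu0 XG (measurable_expRM s))//.
have b0 : 0 < mu - s by rewrite subr_gt0.
pose k := (mu - s) / mu.
have k0 : 0 < k by rewrite divr_gt0.
have tot : (\int[@lebesgue_measure R]_(x in `]0%R, +oo[)
    (gamma_fun mu n x)%:E = 1)%E.
  rewrite -[RHS](integral_cst_probability P).
  under eq_integral do rewrite -[gamma_fun _ _ _]mul1r.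
  apply/esym/(ge0_expectation_gamma mu0 XG (f := cst 1)) => //.
have F1 : derive1 (fun x => k * x) = cst k.
  by apply/funext => x; rewrite derive1Ml// derive1_id mulr1.
have mg : measurable_fun (`]0, +oo[ : set R)
    (fun x : R => (gamma_fun mu n x)%:E).
  apply/measurable_EFinP.
  exact: measurable_funTS (measurable_gamma_fun mu n).
have mgk : measurable_fun (`]0, +oo[ : set R)
    (fun x : R => (gamma_fun mu n (k * x) * k)%:E).
  have m : measurable_fun [set: R] (fun x => gamma_fun mu n (k * x)).
    apply: measurableT_comp; first exact: measurable_gamma_fun.
    exact: mulrl_measurable.
  apply/measurable_EFinP/measurable_funTS.
  exact: (measurable_funM m (measurable_cst k)).
have scal : (\int[@lebesgue_measure R]_(x in `]0%R, +oo[)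
    (gamma_fun mu n (k * x) * k)%:E = 1)%E.
  rewrite -tot !integral_itv_obnd_cbnd//.
  have := @increasing_ge0_integration_by_substitutiony R (fun x => k * x)
    (gamma_fun mu n) 0.
  rewrite F1 mulr0 => ->//.
  - by move=> x y _ _; rewrite ltr_pM2l.
  - by move=> x _; exact: cst_continuous.
  - exact: is_cvg_cst.
  - exact: is_cvg_cst.
  - split; first by move=> x _; exact: derivableM.
    by apply: cvg_at_right_filter; exact: mulrl_continuous.
  - apply: gt0_cvgMry => //; exact: cvg_id.
  - by apply: continuous_subspaceT; exact: continuous_gamma_fun.
  - by move=> x; rewrite in_itv/= andbT => /ltW; exact: gamma_fun_ge0.
have gk x :
    gamma_fun mu n (k * x) * k = k ^+ n.+1 * (expR (s * x) * gamma_fun mu n x).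
  rewrite /gamma_fun (_ : - (mu * (k * x)) = s * x + - (mu * x)); last first.
    by rewrite /k; field; rewrite gt_eqF.
  rewrite expRD exprMn [k ^+ n.+1]exprS; field.
  by rewrite pnatr_eq0 gtn_eqF ?fact_gt0.
have kn0 : 0 < k ^+ n.+1 by exact: exprn_gt0.
move: scal; under eq_integral do rewrite gk EFinM.
rewrite ge0_integralZl_EFin//=; last 3 first.
- move=> x; rewrite in_itv/= andbT => /ltW x0.
  by rewrite lee_fin mulr_ge0 ?expR_ge0 ?gamma_fun_ge0.
- apply/measurable_EFinP/measurable_funTS.
  exact: (measurable_funM (measurable_expRM s) (measurable_gamma_fun mu n)).
- exact: ltW.
case: (\int[_]_(_ in _) _)%E => [y| |]; last 2 first.
- by rewrite gt0_muley ?lte_fin.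
- by rewrite gt0_muleNy ?lte_fin.
rewrite -EFinM => -[] ky; congr (_%:E).
apply: (mulfI (lt0r_neq0 kn0)); rewrite ky -exprMn /k.
by rewrite (_ : _ * _ = 1) ?expr1n//; field; rewrite !gt_eqF.
Qed.

(** For [mu <= s] the value is [+oo] by comparison: the expectations at rates
    [t < mu] are lower bounds and are arbitrarily large as [t] tends to [mu]. *)
Lemma expectation_expR_gamma (R : realType) (d : measure_display)
    (T : measurableType d) (P : probability T R) (mu : R) (n : nat)
    (X : {RV P >-> R}) (s : R) :
  0 < mu -> gammaS_distributed mu n X ->
  (\int[P]_w (expR (s * X w))%:E = gamma_mgf mu n s)%E.
Proof.
move=> mu0 XG; rewrite /gamma_mgf; case: ifPn => [smu|].
  exact: expectation_expR_gamma_lt.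
rewrite -leNgt => mus; apply/eqP; rewrite -leye_eq.
have key M : 1 <= M -> (M%:E <= \int[P]_w (expR (s * X w))%:E)%E.
  move=> M1; have M0 : 0 < M by exact: lt_le_trans M1.
  (* This rate makes mu / (mu - t) equal to M. *)
  pose t := mu * (1 - M^-1).
  have tmu : t < mu by rewrite /t gtr_pMr// gtrBl invr_gt0.
  apply: (@le_trans _ _ ((mu / (mu - t)) ^+ n.+1)%:E).
    rewrite lee_fin (_ : mu / (mu - t) = M); last first.
      rewrite (_ : mu - t = mu / M); last by rewrite /t; ring.
      by rewrite invf_div mulrCA divff ?mulr1// gt_eqF.
    exact: ler_eXnr.
  rewrite -(expectation_expR_gamma_lt mu0 XG tmu).
  rewrite (ge0_expectation_gamma mu0 XG (measurable_expRM t))//.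
  rewrite (ge0_expectation_gamma mu0 XG (measurable_expRM s))//.
  apply: ge0_le_integral => //=.
  - move=> x; rewrite in_itv/= andbT => /ltW x0.
    by rewrite lee_fin mulr_ge0 ?expR_ge0 ?gamma_fun_ge0.
  - apply/measurable_EFinP/measurable_funTS.
    exact: (measurable_funM (measurable_expRM t) (measurable_gamma_fun mu n)).
  - apply/measurable_EFinP/measurable_funTS.
    exact: (measurable_funM (measurable_expRM s) (measurable_gamma_fun mu n)).
  - move=> x; rewrite in_itv/= andbT => /ltW x0; rewrite lee_fin.
    rewrite ler_wpM2r ?gamma_fun_ge0// ler_expR ler_wpM2r//.
    exact: le_trans (ltW tmu) mus.
have : (0 <= \int[P]_w (expR (s * X w))%:E)%E.
  by apply: integral_ge0 => w _; rewrite lee_fin expR_ge0.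
case: (\int[P]_w _)%E key => [y| |]// key y0.
rewrite lee_fin in y0; have := key (y + 1).
by rewrite lerDr => /(_ y0); rewrite lee_fin gerDl ler10.
Qed.

(** * The expected disutility as a function of the quote *)

Lemma lateness_fin (R : realType) (x q : R) :
  lateness x q%:E = Num.max (x - q) 0.
Proof. by rewrite /lateness -EFinB -EFin_max. Qed.

Lemma lateness_pinfty (R : realType) (x : R) : lateness x +oo%E = 0.
Proof. by rewrite /lateness /= maxNye. Qed.

Lemma lateness_ge0 (R : realType) (x : R) (q : \bar R) : 0 <= lateness x q.
Proof. by rewrite /lateness fine_ge0// le_max lexx orbT. Qed.

(** The quote [-oo] is excluded: the lateness [+oo] would be truncated to 0. *)
Lemma lateness_nonincreasing (R : realType) (x : R) (q1 q2 : \bar R) :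
  (-oo < q1)%E -> (q1 <= q2)%E -> lateness x q2 <= lateness x q1.
Proof.
case: q1 => [q1| |]// _; case: q2 => [q2| |]//.
- rewrite lee_fin !lateness_fin ge_max !le_max lexx orbT andbT => q12.
  by rewrite lerB.
- by rewrite lateness_pinfty lateness_ge0.
Qed.

Lemma measurable_lateness (R : realType) (q : \bar R) :
  measurable_fun [set: R] (fun x => lateness x q).
Proof.
case: q => [q| |].
- under eq_fun do rewrite lateness_fin.
  by apply: measurable_maxr => //; exact: measurable_funB.
- rewrite (_ : (fun=> _) = cst 0)//.
  by apply/funext => x; rewrite lateness_pinfty.
- by rewrite (_ : (fun=> _) = cst 0).
Qed.

(** The part of the exponential loss that depends on the time [x] spent in the
    system; the reward and the fee contribute only a constant factor. *)
Definition disutility (R : realType) (c l r : R) (q : \bar R) (x : R) : R :=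
  expR (r * (c * x - l * lateness x q)).

Lemma measurable_disutility (R : realType) (c l r : R) (q : \bar R) :
  measurable_fun [set: R] (disutility c l r q).
Proof.
apply: measurableT_comp => //; apply: measurable_funM => //.
apply: measurable_funB; first exact: mulrl_measurable.
by apply: measurable_funM => //; exact: measurable_lateness.
Qed.

Lemma disutility_nondecreasing (R : realType) (c l r : R) (q1 q2 : \bar R)
    (x : R) :
  0 <= l -> 0 < r -> (-oo < q1)%E -> (q1 <= q2)%E ->
  disutility c l r q1 x <= disutility c l r q2 x.
Proof.
move=> l0 r0 q1y q12; rewrite ler_expR ler_pM2l// lerB// ler_wpM2l//.
exact: lateness_nonincreasing.
Qed.

Definition expected_disutility (R : realType) (d : measure_display)
    (T : measurableType d) (P : probability T R) (X : {RV P >-> R})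
    (c l r : R) (q : \bar R) : \bar R :=
  (\int[P]_w (disutility c l r q (X w))%:E)%E.

(** All questions on the utility, whose expectation may be [-oo], are thereby
    moved to the integral of a nonnegative function. *)
Lemma expected_utilityE (R : realType) (d : measure_display)
    (T : measurableType d) (P : probability T R) (X : {RV P >-> R})
    (rew p c l r : R) (q : \bar R) : 0 < r ->
  (expected_utility X rew p c l r q =
   r^-1%:E - (r^-1 * expR (- (r * (rew - p))))%:E *
     expected_disutility X c l r q)%E.
Proof.
move=> r0.
pose k := r^-1 * expR (- (r * (rew - p))).
have k0 : 0 <= k by rewrite mulr_ge0 ?expR_ge0// invr_ge0 ltW.
have md : measurable_fun [set: T] (EFin \o (disutility c l r q \o X)).
  apply/measurable_EFinP; apply: measurableT_comp => //.
  exact: measurable_disutility.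
rewrite /expected_utility unlock /expected_disutility -/k.
rewrite -ge0_integralZl_EFin//; last by move=> w _; rewrite lee_fin expR_ge0.
rewrite -(@integral_cst_sub_ge0 _ _ _ P).
- apply: eq_integral => w _; rewrite /utility -EFinM -EFinB; congr (_%:E).
  rewrite mulrBl mul1r; congr (_ - _).
  rewrite /k /disutility -mulrA mulrC -expRD; congr (_ * expR _).
  by ring.
- exact: emeasurable_funM.
- by move=> w; rewrite -EFinM lee_fin ltry andbT mulr_ge0// expR_ge0.
Qed.

Lemma expected_disutility_nondecreasing (R : realType) (d : measure_display)
    (T : measurableType d) (P : probability T R) (X : {RV P >-> R})
    (c l r : R) (q1 q2 : \bar R) :
  0 <= l -> 0 < r -> (-oo < q1)%E -> (q1 <= q2)%E ->
  (expected_disutility X c l r q1 <= expected_disutility X c l r q2)%E.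
Proof.
move=> l0 r0 q1y q12.
have md q : measurable_fun [set: T] (EFin \o (disutility c l r q \o X)).
  apply/measurable_EFinP; apply: measurableT_comp => //.
  exact: measurable_disutility.
apply: ge0_le_integral => //; [|exact: md|exact: md|].
  by move=> w _; rewrite lee_fin expR_ge0.
by move=> w _; rewrite lee_fin; exact: disutility_nondecreasing.
Qed.

Lemma expected_disutility_pinfty (R : realType) (d : measure_display)
    (T : measurableType d) (P : probability T R) (mu : R) (n : nat)
    (X : {RV P >-> R}) (c l r : R) :
  0 < mu -> gammaS_distributed mu n X ->
  expected_disutility X c l r +oo%E = gamma_mgf mu n (r * c).
Proof.
move=> mu0 XG; rewrite -(expectation_expR_gamma _ mu0 XG).
apply: eq_integral => w _.
by rewrite /disutility lateness_pinfty mulr0 subr0 mulrA.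
Qed.

(** As [X > 0] almost surely, the lateness under the quote 0 is [X] itself, so
    the compensation just lowers the waiting cost rate from [c] to [c - l]. *)
Lemma expected_disutility0 (R : realType) (d : measure_display)
    (T : measurableType d) (P : probability T R) (mu : R) (n : nat)
    (X : {RV P >-> R}) (c l r : R) :
  0 < mu -> gammaS_distributed mu n X ->
  expected_disutility X c l r 0%E = gamma_mgf mu n (r * (c - l)).
Proof.
move=> mu0 XG; rewrite -(expectation_expR_gamma _ mu0 XG).
rewrite [RHS](ge0_expectation_gamma mu0 XG (measurable_expRM (r * (c - l))))//.
have disu0 x : 0 <= disutility c l r 0 x by exact: expR_ge0.
have md := measurable_disutility c l r 0%E.
transitivity (\int[@lebesgue_measure R]_(x in `]0%R, +oo[)
    (disutility c l r 0 x * gamma_fun mu n x)%:E)%E.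
  exact: ge0_expectation_gamma mu0 XG md disu0.
apply: eq_integral => x; rewrite inE/= in_itv/= andbT => x0.
rewrite /disutility lateness_fin subr0 (max_idPl (ltW x0)).
by congr ((expR _ * _)%:E); ring.
Qed.

(** A nondecreasing function of [q] converges to its supremum at [+oo], so the
    limit may be computed along the integers. There monotone convergence
    applies, each outcome having lateness 0 as soon as the quote exceeds it. *)
Lemma cvg_expected_disutility (R : realType) (d : measure_display)
    (T : measurableType d) (P : probability T R) (X : {RV P >-> R})
    (c l r : R) : 0 <= l -> 0 < r ->
  expected_disutility X c l r q%:E @[q --> +oo%R] -->
    expected_disutility X c l r +oo%E.
Proof.
move=> l0 r0.
pose G (q : R) := expected_disutility X c l r q%:E.
have ndG : nondecreasing_fun G.
  by move=> q1 q2 q12; apply: expected_disutility_nondecreasing; rewrite ?ltNyr.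
have Gsup := nondecreasing_cvge ndG.
suff -> : expected_disutility X c l r +oo%E = ereal_sup (range G) by [].
have Gseq : G k%:R @[k --> \oo] --> ereal_sup (range G).
  by move/cvge_pinftyP : Gsup; apply; exact: cvgr_idn.
suff Glim : G k%:R @[k --> \oo] --> expected_disutility X c l r +oo%E.
  by rewrite -(cvg_lim _ Gseq)// (cvg_lim _ Glim).
pose g (k : nat) w := (disutility c l r k%:R%:E (X w))%:E.
have mg k : measurable_fun [set: T] (g k).
  apply/measurable_EFinP.
  apply: (@measurableT_comp _ _ _ _ _ _ (disutility c l r k%:R%:E)) => //.
  exact: measurable_disutility.
have g0 k w : [set: T] w -> (0 <= g k w)%E.
  by move=> _; rewrite lee_fin expR_ge0.
have ndg w : [set: T] w -> nondecreasing_seq (g^~ w).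
  move=> _ i j ij; rewrite lee_fin; apply: disutility_nondecreasing => //.
    exact: ltNyr.
  by rewrite lee_fin ler_nat.
have := @cvg_monotone_convergence _ _ _ P _ measurableT g mg g0 ndg.
rewrite (_ : (\int[P]_w limn (g^~ w))%E = expected_disutility X c l r +oo%E)//.
apply: eq_integral => w _; apply: cvg_lim => //.
apply: cvg_near_cst; near=> k.
rewrite /g /disutility lateness_pinfty lateness_fin (max_idPr _)// subr_le0.
by near: k; exact: nbhs_infty_ger.
Unshelve. all: by end_near. Qed.

(** * Thresholds *)

Lemma ln_ratio_gt0 (R : realType) (mu s : R) :
  0 < s -> s < mu -> 0 < ln (mu / (mu - s)).
Proof.
move=> s0 smu; have ms0 : 0 < mu - s by rewrite subr_gt0.
rewrite ln_gt0// -[ltLHS](divff (lt0r_neq0 ms0)).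
by rewrite ltr_pM2r ?invr_gt0// gtrBl.
Qed.

(** For [s < mu] the left-hand side says [exp x < (mu/(mu - s))^(n+1)], that is
    [x / ln(mu/(mu - s)) < n + 1]; for [mu <= s] both sides are true, the
    threshold being 0. *)
Lemma utility_lt0_threshold (R : realType) (mu s x r : R) (n : nat) :
  0 < s -> 0 < r ->
  (r^-1%:E - (r^-1 * expR (- x))%:E * gamma_mgf mu n s < 0)%E =
  (threshold_floor x mu s <= n%:Z).
Proof.
move=> s0 r0; rewrite /gamma_mgf /threshold_floor /ln_ratio.
have ri0 : 0 < r^-1 by rewrite invr_gt0.
case: (ltP s mu) => [smu|mus]; last first.
  rewrite invey mule0/= floor0 gt0_muley ?lte_fin ?mulr_gt0 ?expR_gt0//.
  by rewrite addeNy ltNyr le0z_nat.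
have ms0 : 0 < mu - s by rewrite subr_gt0.
have rho0 : 0 < mu / (mu - s) by rewrite divr_gt0// (lt_trans s0).
have L0 := ln_ratio_gt0 s0 smu.
rewrite inver gt_eqF//= -EFinD lte_fin.
rewrite subr_lt0 -mulrA ltr_pMr// mulrC -ltr_pdivrMr ?expR_gt0//.
rewrite div1r expRN invrK.
rewrite -[in LHS](lnK rho0) -expRM_natl ltr_expR.
by rewrite -ltzD1 floor_lt_int ltr_pdivrMr// intrD natr1.
Qed.

Lemma nat_inf_ge (R : realType) (m : nat) (S : set nat) :
  (forall n, S n <-> (m <= n)%N) -> nat_inf R S = m%:R%:E.
Proof.
move=> Sm; apply/eqP; rewrite eq_le; apply/andP; split.
  by apply: ereal_inf_lbound; exists m => //; exact/Sm.
by apply: le_ereal_inf_tmp => _ [n /Sm mn <-]; rewrite lee_fin ler_nat.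
Qed.

Lemma threshold_floor_ge0 (R : realType) (mu s x : R) :
  0 < s -> 0 <= x -> 0 <= threshold_floor x mu s.
Proof.
move=> s0 x0; rewrite /threshold_floor /ln_ratio floor_ge0.
case: (ltP s mu) => [smu|mus]; last by rewrite invey mule0.
have L0 := ln_ratio_gt0 s0 smu.
by rewrite inver gt_eqF//= divr_ge0// ltW.
Qed.

Theorem proposition1 (R : realType) (disp : measure_display)
    (T : measurableType disp) (P : probability T R)
    (mu rew p c l r : R) (X : nat -> {RV P >-> R}) (D : nat -> \bar R)
    (mu_gt0 : 0 < mu) (c_gt0 : 0 < c) (r_gt0 : 0 < r)
    (p_ge0 : 0 <= p) (p_le_rew : p <= rew) (l_ge0 : 0 <= l) (l_le_c : l <= c)
    (X_gamma : forall n : nat, gammaS_distributed mu n (X n))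
    (D_ge0 : forall n : nat, (0 <= D n)%E)
    (l_lt_c : l < c) :
  let B (n : nat) (q : \bar R) := expected_utility (X n) rew p c l r q in
  let n_lo : \bar R :=
    nat_inf R [set n : nat | (lim (B n q%:E @[q --> +oo%R]) < 0)%E] in
  let n_hi : \bar R := nat_inf R [set n : nat | (B n 0%E < 0)%E] in
  [/\ forall n : nat, cvg (B n q%:E @[q --> +oo%R]),
      n_lo = (threshold_floor (r * (rew - p)) mu (r * c))%:~R%:E,
      n_hi = (threshold_floor (r * (rew - p)) mu (r * (c - l)))%:~R%:E &
      exists n0 : nat,
        [/\ nat_min [set n : nat | (B n (D n) < 0)%E] n0,
            (n_lo <= n0%:R%:E)%E & (n0%:R%:E <= n_hi)%E]].
Proof.
move=> B n_lo n_hi; rewrite /n_lo /n_hi {n_lo n_hi}.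
pose k := r^-1 * expR (- (r * (rew - p))).
have k0 : 0 <= k by rewrite mulr_ge0 ?expR_ge0// invr_ge0 ltW.
have BE n q : B n q = (r^-1%:E - k%:E * expected_disutility (X n) c l r q)%E.
  exact: expected_utilityE.
have Bmono n q1 q2 : (-oo < q1)%E -> (q1 <= q2)%E -> (B n q2 <= B n q1)%E.
  move=> q1y q12.
  have := expected_disutility_nondecreasing (X n) c l_ge0 r_gt0 q1y q12.
  rewrite !{}BE; move: (expected_disutility _ _ _ _ q1).
  move: (expected_disutility _ _ _ _ q2) => G2 G1 G12.
  exact: leeB (lexx _) (lee_wpmul2l _ G12).
have Bcvg n : B n q%:E @[q --> +oo%R] --> B n +oo%E.
  have := @cvg_expected_disutility _ _ _ _ (X n) c _ _ l_ge0 r_gt0.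
  rewrite BE (_ : (fun q => B n q%:E) =
      (fun q => r^-1%:E - k%:E * expected_disutility (X n) c l r q%:E)%E).
  2: by apply/funext => q; exact: BE.
  move: (expected_disutility _ _ _ _) => G GC.
  apply: (@cvgeB _ _ _ _ (cst r^-1%:E) (fun q => k%:E * G q%:E)%E).
  - exact: fin_num_adde_defr.
  - exact: cvg_cst.
  - exact: cvgeZl.
have x0 : 0 <= r * (rew - p) by rewrite mulr_ge0 ?subr_ge0// ltW.
have rc0 : 0 < r * c by exact: mulr_gt0.
have rcl0 : 0 < r * (c - l) by rewrite mulr_gt0// subr_gt0.
have floor_nat a : 0 < a ->
    exists m : nat, threshold_floor (r * (rew - p)) mu a = m.
  move=> a0; exists `|threshold_floor (r * (rew - p)) mu a|%N.
  by rewrite gez0_abs// threshold_floor_ge0.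
have [[m_lo m_loE] [m_hi m_hiE]] := (floor_nat _ rc0, floor_nat _ rcl0).
have Boo n : (B n +oo < 0)%E = (m_lo <= n)%N.
  rewrite BE (expected_disutility_pinfty _ _ _ mu_gt0 (X_gamma n)).
  by rewrite utility_lt0_threshold// m_loE lez_nat.
have B0 n : (B n 0 < 0)%E = (m_hi <= n)%N.
  rewrite BE (expected_disutility0 _ _ _ mu_gt0 (X_gamma n)).
  by rewrite utility_lt0_threshold// m_hiE lez_nat.
have n_loE :
    nat_inf R [set n | (lim (B n q%:E @[q --> +oo%R]) < 0)%E] = m_lo%:R%:E.
  apply: nat_inf_ge => n /=.
  by rewrite (cvg_lim _ (Bcvg n))// Boo.
have n_hiE : nat_inf R [set n | (B n 0 < 0)%E] = m_hi%:R%:E.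
  by apply: nat_inf_ge => n /=; rewrite B0.
split.
- by move=> n; apply/cvg_ex; exists (B n +oo%E); exact: Bcvg.
- by rewrite n_loE m_loE.
- by rewrite n_hiE m_hiE.
have BD_hi : (B m_hi (D m_hi) < 0)%E.
  apply: (@le_lt_trans _ _ (B m_hi 0%E)); last by rewrite B0.
  by apply: Bmono; rewrite ?ltNyr.
have [n0 Bn0 n0min] :=
  ex_minnP (ex_intro (fun n => (B n (D n) < 0)%E) m_hi BD_hi).
exists n0; split.
- by split => // n; exact: n0min.
- rewrite n_loE lee_fin ler_nat -Boo; apply: le_lt_trans Bn0.
  by apply: Bmono; [exact: lt_le_trans (D_ge0 n0)|exact: leey].
- by rewrite n_hiE lee_fin ler_nat; exact: n0min.
Qed.
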